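(* Let $(E_n)_{n\ge 0}$ be the Perrin sequence: $E_0=3$, $E_1=0$, $E_2=2$ and $E_n=E_{n-2}+E_{n-3}$ for $n\ge 3$. Then for every integer $n\ge 0$: (a) $\sum_{k=0}^{n}E_{k}=E_{n+3}+E_{n+2}-2.$ (b) $\sum_{k=0}^{n}E_{2k}=E_{2n+1}+E_{2n}.$ (c) $\sum_{k=0}^{n}E_{2k+1}=E_{2n+2}+E_{2n+1}-2.$ *)

(* Defs.v *)
From mathcomp Require Import all_boot all_order all_algebra.

Set Implicit Arguments.
Unset Strict Implicit.
Unset Printing Implicit Defensive.

Import GRing.Theory.
Local Open Scope ring_scope.

(* Integer-valued, so that the subtractions in identities between its terms
   are not truncated. *)
Fixpoint perrin (n : nat) : int :=
  match n with
  | 0%N => 3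
  | 1%N => 0
  | 2%N => 2
  | ((m.+1 as m1).+1).+1 => perrin m1 + perrin m
  end.

(* Main.v *)
Require Import Defs.
From mathcomp Require Import all_boot all_order all_algebra.
From mathcomp Require Import ring.

Local Open Scope ring_scope.

(** All three sums telescope: by the recurrence, passing from [n] to [n.+1] makes each right-hand
    side grow by exactly the new summand. The constants are fixed by the case [n = 0]. *)

Lemma perrinSSS (n : nat) : perrin n.+3 = perrin n.+1 + perrin n.
Proof. by []. Qed.

Theorem corollary2p11 (n : nat) :
  [/\ \sum_(0 <= k < n.+1) perrin k = perrin (n + 3) + perrin (n + 2) - 2,
      \sum_(0 <= k < n.+1) perrin (2 * k) =
        perrin (2 * n + 1) + perrin (2 * n)
    & \sum_(0 <= k < n.+1) perrin (2 * k + 1) =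
        perrin (2 * n + 2) + perrin (2 * n + 1) - 2].
Proof.
elim: n => [|n [IHa IHb IHc]]; first by rewrite !big_nat1.
rewrite !(big_nat_recr n.+1) // IHa IHb IHc.
(* Indices become successors of [n] or [2 * n], so that the recurrence leaves only three consecutive
   terms from each base, and the goals are linear in these. *)
rewrite mulnS add2n !addSn !addn1 !addn2 !addn3 !perrinSSS.
by split; rewrite [LHS]/=; ring.
Qed.
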